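(* Let $(X,\leq)$ be a partial order and $U$ a predicate on $X$, and assume that induction holds for $U$ and $X$. If $U$ is meet-closed and good, then $U(x)$ holds for all $x\in X$.
   Context: For $x,y\in X$, $y>x$ means $y\geq x$ and $y\neq x$. A predicate $U$ on $X$ is progressive if for every $x\in X$: if $U(y)$ holds for all $y\in X$ with $y>x$, then $U(x)$ holds. ''Induction holds for $U$ and $X$'' means: if $U$ is progressive, then $U(x)$ holds for all $x\in X$. For $x,y,z\in X$, $x=y\wedge z$ means that $x$ is the greatest lower bound of $y$ and $z$, i.e. for all $x'\in X$, $x'\leq x$ iff ($x'\leq y$ and $x'\leq z$). An element $x\in X$ is reducible if there are $y,z\in X$ with $x<y$, $x<z$ and $x=y\wedge z$. $U$ is good if for every $x\in X$, either $U(x)$ holds or $x$ is reducible. $U$ is meet-closed if whenever $x=y\wedge z$ in $X$, $U(y)$ and $U(z)$ together imply $U(x)$. (The setting is intuitionistic logic.) *)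

(* Defs.v *)
From Stdlib Require Import Relation_Definitions.

Definition lt {X : Type} (le : relation X) (x y : X) : Prop :=
  le x y /\ y <> x.

Definition progressive {X : Type} (le : relation X) (U : X -> Prop) : Prop :=
  forall x : X, (forall y : X, lt le x y -> U y) -> U x.

Definition induction_holds {X : Type} (le : relation X) (U : X -> Prop) : Prop :=
  progressive le U -> forall x : X, U x.

(* [is_meet le x y z] is "x = y /\ z" in the order [le]; meets are partial,
   so this is a relation rather than an operation. *)
Definition is_meet {X : Type} (le : relation X) (x y z : X) : Prop :=
  forall x' : X, le x' x <-> le x' y /\ le x' z.

Definition reducible {X : Type} (le : relation X) (x : X) : Prop :=
  exists y z : X, lt le x y /\ lt le x z /\ is_meet le x y z.

Definition good {X : Type} (le : relation X) (U : X -> Prop) : Prop :=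
  forall x : X, U x \/ reducible le x.

Definition meet_closed {X : Type} (le : relation X) (U : X -> Prop) : Prop :=
  forall x y z : X, is_meet le x y z -> U y -> U z -> U x.

(* Main.v *)
Require Import Defs.
From Stdlib Require Import Relation_Definitions.

(** Goodness and meet-closure together make [U] progressive: a reducible point is a meet of two
    strictly larger points, where [U] holds by the induction hypothesis, and meet-closure carries
    [U] down to it. *)

Theorem theorem4p2 (X : Type) (le : relation X) (le_order : order X le)
    (U : X -> Prop) (ind : induction_holds le U)
    (U_meet : meet_closed le U) (U_good : good le U) :
  forall x : X, U x.
Proof.
  apply ind. intros x IH.
  (* The disjunction comes from goodness itself, so the case split is intuitionistic; strictness of
     [xy] and [xz] lets [IH] apply. *)
  destruct (U_good x) as [Ux | (y & z & xy & xz & meet)].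
  - exact Ux.
  - exact (U_meet x y z meet (IH y xy) (IH z xz)).
Qed.
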